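(* Let $(\mathcal X,\mathcal Y)$ be a balanced pair in an abelian category $\mathcal A$ and let $(\mathcal C,\mathcal D)$ be a cotorsion pair relative to $(\mathcal X,\mathcal Y)$. Then the following statements are equivalent. (1) $\mathcal C$ is $\mathcal X$-resolving. (2) $\mathcal D$ is $\mathcal Y$-coresolving. (3) $\operatorname{Ext}_\ast^{i}(C,D)=0$ for all $i\ge 1$, all $C\in\mathcal C$ and all $D\in\mathcal D$.
   Context: $\mathcal A$ is an abelian category; a subcategory of $\mathcal A$ means a full additive subcategory closed under isomorphisms and direct summands. A morphism $f:X\to M$ with $X\in\mathcal X$ is a right $\mathcal X$-approximation of $M$ if every morphism $X'\to M$ with $X'\in\mathcal X$ factors through $f$; $\mathcal X$ is contravariantly finite in $\mathcal A$ if every object of $\mathcal A$ has a right $\mathcal X$-approximation. Left approximations and covariantly finite subcategories are defined dually. A complex $A^\bullet$ in $\mathcal A$ is right $\mathcal X$-acyclic if $\operatorname{Hom}_{\mathcal A}(X,A^\bullet)$ is acyclic for all $X\in\mathcal X$, and left $\mathcal X$-acyclic if $\operatorname{Hom}_{\mathcal A}(A^\bullet,X)$ is acyclic for all $X\in\mathcal X$. For $\mathcal X$ contravariantly finite, an $\mathcal X$-resolution of $M$ is a right $\mathcal X$-acyclic complex $\cdots\to X^{-1}\to X^0\to M\to 0$ with all $X^i\in\mathcal X$; the complex $X^\bullet=(\cdots\to X^{-1}\to X^0\to 0)$ is the deleted resolution. For $\mathcal Y$ covariantly finite, a $\mathcal Y$-coresolution of $N$ is a left $\mathcal Y$-acyclic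 complex $0\to N\to Y^0\to Y^1\to\cdots$ with all $Y^i\in\mathcal Y$. A pair $(\mathcal X,\mathcal Y)$ of subcategories is a balanced pair if $\mathcal X$ is contravariantly finite, $\mathcal Y$ is covariantly finite, every $M\in\mathcal A$ has an $\mathcal X$-resolution that is left $\mathcal Y$-acyclic, and every $N\in\mathcal A$ has a $\mathcal Y$-coresolution that is right $\mathcal X$-acyclic. In that case a complex is right $\mathcal X$-acyclic if and only if it is left $\mathcal Y$-acyclic; such complexes are called $\ast$-acyclic. For $M,N\in\mathcal A$ put $\operatorname{Ext}_\ast^i(M,N):=H^i(\operatorname{Hom}_{\mathcal A}(X^\bullet,N))\cong H^i(\operatorname{Hom}_{\mathcal A}(M,Y^\bullet))$, where $X^\bullet\to M$ is an $\mathcal X$-resolution and $N\to Y^\bullet$ a $\mathcal Y$-coresolution (independent of choices). A pair $(\mathcal C,\mathcal D)$ of subcategories is a cotorsion pair relative to $(\mathcal X,\mathcal Y)$ if $\mathcal C=\{C\in\mathcal A\mid \operatorname{Ext}^1_\ast(C,D)=0\ \forall D\in\mathcal D\}$ and $\mathcal D=\{D\in\mathcal A\mid \operatorname{Ext}^1_\ast(C,D)=0\ \forall C\in\mathcal C\}$. A subcategory $\mathcal E$ is closed under $\ast$-extensions (resp. $\ast$-epimorphisms, $\ast$-monomorphisms) if for every $\ast$-acyclic complex $0\to L\to M\to N\to 0$, $L,N\in\mathcal E$ implies $M\in\mathcal E$ (resp. $M,N\in\mathcal E$ implies $L\in\mathcal E$; $L,M\in\mathcal E$ implies $N\in\mathcal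 E$). $\mathcal E$ is $\mathcal X$-resolving if $\mathcal X\subseteq\mathcal E$ and $\mathcal E$ is closed under $\ast$-extensions and $\ast$-epimorphisms; $\mathcal E$ is $\mathcal Y$-coresolving if $\mathcal Y\subseteq\mathcal E$ and $\mathcal E$ is closed under $\ast$-extensions and $\ast$-monomorphisms. *)

(* Defs.v *)
From HB Require Import structures.
From mathcomp Require Import all_boot all_order all_algebra.
From mathcomp Require Import boolp.

Set Implicit Arguments.
Unset Strict Implicit.
Unset Printing Implicit Defensive.

Import GRing.Theory.
Local Open Scope ring_scope.

Declare Scope cat_scope.
Delimit Scope cat_scope with cat.

Definition exact_at (U V W : zmodType) (f : U -> V) (g : V -> W) : Prop :=
  forall v : V, g v = 0 <-> exists u : U, f u = v.

Section Cohomology.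
Variables (U V W : zmodType) (f : {additive U -> V}) (g : {additive V -> W}).

Definition is_cocycle : pred V := fun v => g v == 0.

Fact is_cocycle_zmod_closed : zmod_closed is_cocycle.
Proof.
split=> [|u v]; first by rewrite unfold_in raddf0.
by rewrite !unfold_in raddfB => /eqP-> /eqP->; rewrite subrr.
Qed.
HB.instance Definition _ :=
  GRing.isZmodClosed.Build V is_cocycle is_cocycle_zmod_closed.

Record cocycle := Cocycle { cocycle_val : V; _ : cocycle_val \in is_cocycle }.

HB.instance Definition _ := [isSub for cocycle_val].
HB.instance Definition _ := [Choice of cocycle by <:].
HB.instance Definition _ := [SubChoice_isSubZmodule of cocycle by <:].

Definition is_coboundary : pred cocycle :=
  fun z => `[< exists u : U, f u = \val z >].

Fact is_coboundary_zmod_closed : zmod_closed is_coboundary.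
Proof.
split=> [|y z]; rewrite !unfold_in.
  by apply/asboolP; exists 0; rewrite !raddf0.
move=> /asboolP[u fu] /asboolP[v fv].
by apply/asboolP; exists (u - v); rewrite !raddfB fu fv.
Qed.
HB.instance Definition _ :=
  GRing.isZmodClosed.Build cocycle is_coboundary is_coboundary_zmod_closed.

Definition coboundaries : zmodClosed cocycle :=
  GRing.ZmodClosed.clone cocycle is_coboundary _.

(* The quotient of ker g by the elements of ker g lying in im f; it is the
   usual cohomology group ker g / im f when g \o f = 0. *)
Definition cohomology : zmodType := Quotient.quot coboundaries.

End Cohomology.

Definition trivial_group (G : zmodType) : Prop := forall x : G, x = 0.

Record preadditive := Preadditive {
  obj :> Type;
  Hom : obj -> obj -> zmodType;
  idm : forall a, Hom a a;
  cmp : forall a b c, Hom b c -> Hom a b -> Hom a c;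
  cmpA : forall a b c d (h : Hom c d) (g : Hom b c) (f : Hom a b),
    cmp h (cmp g f) = cmp (cmp h g) f;
  cmp1m : forall a b (f : Hom a b), cmp (idm b) f = f;
  cmpm1 : forall a b (f : Hom a b), cmp f (idm a) = f;
  cmpDl : forall a b c (g g' : Hom b c) (f : Hom a b),
    cmp (g + g') f = cmp g f + cmp g' f;
  cmpDr : forall a b c (g : Hom b c) (f f' : Hom a b),
    cmp g (f + f') = cmp g f + cmp g f'
}.
Arguments Hom {p} a b.
Arguments idm {p} a.
Arguments cmp {p a b c} g f.

Notation "g \cmp f" := (cmp g f)
  (at level 40, left associativity) : cat_scope.
Local Open Scope cat_scope.

Section PreadditiveTheory.
Variable A : preadditive.
Implicit Types a b c s x : A.

Definition is_iso a b (f : Hom a b) : Prop :=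
  exists g : Hom b a, g \cmp f = idm a /\ f \cmp g = idm b.

Definition isomorphic a b : Prop := exists f : Hom a b, is_iso f.

Definition is_mono b c (g : Hom b c) : Prop :=
  forall a (f f' : Hom a b), g \cmp f = g \cmp f' -> f = f'.

Definition is_epi a b (f : Hom a b) : Prop :=
  forall c (g g' : Hom b c), g \cmp f = g' \cmp f -> g = g'.

Definition is_zero_object a : Prop :=
  forall b, (forall f : Hom a b, f = 0) /\ (forall f : Hom b a, f = 0).

Definition is_biproduct a b s : Prop :=
  exists (i : Hom a s) (j : Hom b s) (p : Hom s a) (q : Hom s b),
    [/\ p \cmp i = idm a, q \cmp j = idm b, p \cmp j = 0, q \cmp i = 0
      & i \cmp p + j \cmp q = idm s].

Definition is_kernel k a b (i : Hom k a) (f : Hom a b) : Prop :=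
  f \cmp i = 0 /\
  forall c (g : Hom c a), f \cmp g = 0 -> exists! h : Hom c k, i \cmp h = g.

Definition is_cokernel a b c (p : Hom b c) (f : Hom a b) : Prop :=
  p \cmp f = 0 /\
  forall x (g : Hom b x), g \cmp f = 0 -> exists! h : Hom c x, h \cmp p = g.

(* The maps Hom(x, f) and Hom(f, y). *)
Definition postcomp x a b (f : Hom a b) : Hom x a -> Hom x b :=
  fun u => f \cmp u.
Definition precomp a b (f : Hom a b) (y : A) : Hom b y -> Hom a y :=
  fun u => u \cmp f.

Fact postcomp_is_zmod_morphism x a b (f : Hom a b) :
  zmod_morphism (@postcomp x a b f).
Proof.
move=> u v; apply/(addIr (f \cmp v)).
by rewrite /postcomp subrK -cmpDr subrK.
Qed.
HB.instance Definition _ x a b (f : Hom a b) :=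
  GRing.isZmodMorphism.Build (Hom x a) (Hom x b) (@postcomp x a b f)
    (@postcomp_is_zmod_morphism x a b f).

Fact precomp_is_zmod_morphism a b (f : Hom a b) y :
  zmod_morphism (@precomp a b f y).
Proof.
move=> u v; apply/(addIr (v \cmp f)).
by rewrite /precomp subrK -cmpDl subrK.
Qed.
HB.instance Definition _ a b (f : Hom a b) y :=
  GRing.isZmodMorphism.Build (Hom b y) (Hom a y) (@precomp a b f y)
    (@precomp_is_zmod_morphism a b f y).

End PreadditiveTheory.

Arguments postcomp {A} x {a b} f.
Arguments precomp {A a b} f y.

Record abelian_category := AbelianCategory {
  abelian_preadditive :> preadditive;
  zero_obj : abelian_preadditive;
  zero_objP : is_zero_object zero_obj;
  abelian_biproduct : forall a b : abelian_preadditive,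
    exists s, is_biproduct a b s;
  abelian_kernel : forall (a b : abelian_preadditive) (f : Hom a b),
    exists k (i : Hom k a), is_kernel i f;
  abelian_cokernel : forall (a b : abelian_preadditive) (f : Hom a b),
    exists c (p : Hom b c), is_cokernel p f;
  abelian_mono : forall (a b : abelian_preadditive) (i : Hom a b),
    is_mono i -> exists c (f : Hom b c), is_kernel i f;
  abelian_epi : forall (a b : abelian_preadditive) (p : Hom a b),
    is_epi p -> exists c (f : Hom c a), is_cokernel p f
}.
Arguments zero_obj {_}.

(* A full subcategory is encoded by its class of objects. *)
Record subcategory (A : abelian_category) := Subcategory {
  subcat_mem :> A -> Prop;
  subcat_zero : subcat_mem zero_obj;
  subcat_biproduct : forall a b s : A,
    is_biproduct a b s -> subcat_mem a -> subcat_mem b -> subcat_mem s;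
  subcat_iso : forall a b : A, isomorphic a b -> subcat_mem a -> subcat_mem b;
  subcat_summand : forall a b s : A,
    is_biproduct a b s -> subcat_mem s -> subcat_mem a
}.

Section Relative.
Variable A : abelian_category.
Implicit Types (X Y E : subcategory A) (L M N x y : A).

Definition right_approximation X x M (f : Hom x M) : Prop :=
  X x /\ forall x', X x' -> forall g : Hom x' M, exists h, f \cmp h = g.

Definition left_approximation Y N y (f : Hom N y) : Prop :=
  Y y /\ forall y', Y y' -> forall g : Hom N y', exists h, h \cmp f = g.

Definition contravariantly_finite X : Prop :=
  forall M, exists x (f : Hom x M), right_approximation X f.

Definition covariantly_finite Y : Prop :=
  forall N, exists y (f : Hom N y), left_approximation Y f.

(* The successor i + 1, in a form that computes on constructors, so that the
   differentials of the concrete complexes below typecheck. *)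
Definition succi (i : int) : int :=
  match i with
  | Posz n => Posz n.+1
  | Negz 0 => Posz 0
  | Negz n.+1 => Negz n
  end.

Fact succiE (i : int) : succi i = i + 1.
Proof.
case: i => [n|[|n]] //; rewrite /succi; first by rewrite intS addrC.
by rewrite !NegzE (intS n.+1) opprD addrAC addNr add0r.
Qed.

Record complex := Complex {
  cx_obj :> int -> A;
  cx_d : forall i, Hom (cx_obj i) (cx_obj (succi i));
  cx_dd : forall i, cx_d (succi i) \cmp cx_d i = 0
}.

(* Since succi is a bijection, the conditions below range over all degrees. *)
Definition right_acyclic X (K : complex) : Prop :=
  forall x, X x -> forall i : int,
    exact_at (postcomp x (cx_d K i)) (postcomp x (cx_d K (succi i))).

Definition left_acyclic Y (K : complex) : Prop :=
  forall y, Y y -> forall i : int,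
    exact_at (precomp (cx_d K (succi i)) y) (precomp (cx_d K i) y).

(* ... -> P 1 -> P 0 -> M -> 0, with P n standing for the term X^(-n). *)
Record left_augmented M := LeftAugmented {
  la_obj :> nat -> A;
  la_d : forall n, Hom (la_obj n.+1) (la_obj n);
  la_aug : Hom (la_obj 0) M;
  la_dd : forall n, la_d n \cmp la_d n.+1 = 0;
  la_augd : la_aug \cmp la_d 0 = 0
}.

(* 0 -> N -> Q 0 -> Q 1 -> ... *)
Record right_augmented N := RightAugmented {
  ra_obj :> nat -> A;
  ra_d : forall n, Hom (ra_obj n) (ra_obj n.+1);
  ra_aug : Hom N (ra_obj 0);
  ra_dd : forall n, ra_d n.+1 \cmp ra_d n = 0;
  ra_daug : ra_d 0 \cmp ra_aug = 0
}.

Fact cmp0m (a b c : A) (f : Hom a b) : (0 : Hom b c) \cmp f = 0.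
Proof. exact: (raddf0 (precomp f c)). Qed.

Fact cmpm0 (a b c : A) (g : Hom b c) : g \cmp (0 : Hom a b) = 0.
Proof. exact: (raddf0 (postcomp a g)). Qed.

Section OfLeftAugmented.
Variables (M : A) (P : left_augmented M).

Definition lcx_obj (i : int) : A :=
  match i with
  | Negz n => P n
  | Posz 0 => M
  | Posz _.+1 => zero_obj
  end.

Definition lcx_d (i : int) : Hom (lcx_obj i) (lcx_obj (succi i)) :=
  match i with
  | Negz n.+1 => la_d P n
  | Negz 0 => la_aug P
  | Posz _ => 0
  end.

Fact lcx_dd i : lcx_d (succi i) \cmp lcx_d i = 0.
Proof.
case: i => [n|[|[|n]]]; [exact: cmpm0|exact: cmp0m|exact: la_augd|exact: la_dd].
Qed.

Definition left_augmented_complex : complex := Complex lcx_dd.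

End OfLeftAugmented.

Section OfRightAugmented.
Variables (N : A) (Q : right_augmented N).

Definition rcx_obj (i : int) : A :=
  match i with
  | Posz n.+1 => Q n
  | Posz 0 => N
  | Negz _ => zero_obj
  end.

Definition rcx_d (i : int) : Hom (rcx_obj i) (rcx_obj (succi i)) :=
  match i with
  | Posz n.+1 => ra_d Q n
  | Posz 0 => ra_aug Q
  | Negz _ => 0
  end.

Fact rcx_dd i : rcx_d (succi i) \cmp rcx_d i = 0.
Proof.
case: i => [[|n]|n]; [exact: ra_daug|exact: ra_dd|exact: cmpm0].
Qed.

Definition right_augmented_complex : complex := Complex rcx_dd.

End OfRightAugmented.

Section ShortComplex.
Variables (L M N : A) (f : Hom L M) (g : Hom M N) (gf0 : g \cmp f = 0).

Definition scx_obj (i : int) : A :=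
  match i with
  | Posz 0 => L
  | Posz 1 => M
  | Posz 2 => N
  | _ => zero_obj
  end.

Definition scx_d (i : int) : Hom (scx_obj i) (scx_obj (succi i)) :=
  match i with
  | Posz 0 => f
  | Posz 1 => g
  | _ => 0
  end.

Fact scx_dd i : scx_d (succi i) \cmp scx_d i = 0.
Proof.
by case: i => [[|[|n]]|n]; [exact: gf0|exact: cmp0m|exact: cmpm0|exact: cmpm0].
Qed.

(* 0 -> L -> M -> N -> 0 *)
Definition short_complex : complex := Complex scx_dd.

End ShortComplex.

Record resolution X M := Resolution {
  res_aug :> left_augmented M;
  res_mem : forall n, X (res_aug n);
  res_acyclic : right_acyclic X (left_augmented_complex res_aug)
}.

Record coresolution Y N := Coresolution {
  cores_aug :> right_augmented N;
  cores_mem : forall n, Y (cores_aug n);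
  cores_acyclic : left_acyclic Y (right_augmented_complex cores_aug)
}.

Record balanced_pair X Y : Prop := BalancedPair {
  bp_contravariantly_finite : contravariantly_finite X;
  bp_covariantly_finite : covariantly_finite Y;
  bp_resolution : forall M, exists P : resolution X M,
    left_acyclic Y (left_augmented_complex P);
  bp_coresolution : forall N, exists Q : coresolution Y N,
    right_acyclic X (right_augmented_complex Q)
}.

(* Over a balanced pair either condition implies the other. *)
Definition star_acyclic X Y (K : complex) : Prop :=
  right_acyclic X K /\ left_acyclic Y K.

(* The differential leaving P n in the deleted complex
   ... -> P 1 -> P 0 -> 0. *)
Definition deleted_d M (P : left_augmented M) (n : nat) :
    Hom (P n) (if n is m.+1 then P m else zero_obj) :=
  match n with
  | 0 => 0
  | m.+1 => la_d P m
  end.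

(* H^i(Hom(P, N)) for the deleted complex P. *)
Definition hom_cohomology M (P : left_augmented M) N (i : nat) : zmodType :=
  cohomology (precomp (deleted_d P i) N) (precomp (la_d P i) N).

Definition chosen_resolution X Y (bp : balanced_pair X Y) M : resolution X M :=
  sval (cid (bp_resolution bp M)).

(* Up to isomorphism, Ext does not depend on the chosen resolution. *)
Definition Ext X Y (bp : balanced_pair X Y) (i : nat) M N : zmodType :=
  hom_cohomology (chosen_resolution bp M) N i.

Definition cotorsion_pair X Y (bp : balanced_pair X Y)
    (C D : subcategory A) : Prop :=
  (forall M, C M <-> forall N, D N -> trivial_group (Ext bp 1 M N)) /\
  (forall N, D N <-> forall M, C M -> trivial_group (Ext bp 1 M N)).

Definition closed_star_extensions X Y E : Prop :=
  forall L M N (f : Hom L M) (g : Hom M N) (gf0 : g \cmp f = 0),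
    star_acyclic X Y (short_complex gf0) -> E L -> E N -> E M.

Definition closed_star_epimorphisms X Y E : Prop :=
  forall L M N (f : Hom L M) (g : Hom M N) (gf0 : g \cmp f = 0),
    star_acyclic X Y (short_complex gf0) -> E M -> E N -> E L.

Definition closed_star_monomorphisms X Y E : Prop :=
  forall L M N (f : Hom L M) (g : Hom M N) (gf0 : g \cmp f = 0),
    star_acyclic X Y (short_complex gf0) -> E L -> E M -> E N.

Definition X_resolving X Y E : Prop :=
  [/\ forall M, X M -> E M,
      closed_star_extensions X Y E
    & closed_star_epimorphisms X Y E].

Definition Y_coresolving X Y E : Prop :=
  [/\ forall M, Y M -> E M,
      closed_star_extensions X Y E
    & closed_star_monomorphisms X Y E].

End Relative.

(* Main.v *)
From mathcomp Require Import all_boot all_algebra.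
From mathcomp Require Import boolp.
Require Import Defs.

(** Call an [X]-resolution which is also left [Y]-acyclic a star-acyclic
    resolution. The equivalence follows from two implications, valid for every
    cotorsion pair [(C, D)] relative to every balanced pair [(X, Y)]:

    - if [C] is [X]-resolving, then [Ext^i(C, D) = 0] for all [i >= 1]
      ([resolving_Ext_orthogonal]);
    - if [Ext^i(C, D) = 0] for all [i >= 1], then [D] is [Y]-coresolving
      ([Ext_orthogonal_coresolving]).

    Their composite, applied in the opposite category to the cotorsion pair
    [(D, C)] relative to the balanced pair [(Y, X)], says that if [D] is
    [Y]-coresolving then [C] is [X]-resolving, which closes the circle.

    The first implication is dimension shifting. If [P] is a star-acyclic
    resolution of [M] and [K] is the kernel of [P 0 -> M], then
    [0 -> K -> P 0 -> M -> 0] is star-acyclic, so [K] lies in [C] as soon as [M]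
    does, and [P] without [P 0] is a star-acyclic resolution of [K]
    ([syzygy_exists]). Augmentations need not be epimorphisms, as [X] need not
    generate; the substitute is that they induce injections on morphisms into
    objects of [Y] ([approximation_inj]).

    The second implication uses that the functors [Hom(P n, -)] turn a
    star-acyclic complex [0 -> L -> M -> N -> 0] into short exact sequences, so
    that the required pieces of the long exact sequence of Ext in the second
    variable can be chased by hand. Objects of [Y] lie in [D] because [P] is left
    [Y]-acyclic.

    What remains is to compare [Ext^1] computed from a resolution of [M] with
    [Ext^1] computed from a coresolution [Q] of [N], which is a chase in the
    double complex [Hom(P i, Q j)] ([ext1_vanishes_balance]). It shows that the
    vanishing of [Ext^1] depends on no choice of resolution, and that cotorsion
    pairs pass to the opposite category. Since the theorem only speaks of
    vanishing, no Ext group is compared beyond that, and no comparison in higher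
    degrees is needed. *)

Set Implicit Arguments.
Unset Strict Implicit.
Unset Printing Implicit Defensive.

Import GRing.Theory.
Local Open Scope ring_scope.
Local Open Scope cat_scope.

(** * Computing with morphisms *)

Section Morphisms.
Variable A : abelian_category.
Implicit Types a b c : A.

Lemma cmpBl a b c (g g' : Hom b c) (f : Hom a b) :
  (g - g') \cmp f = g \cmp f - g' \cmp f.
Proof. exact: (raddfB (precomp f c)). Qed.

Lemma cmpBr a b c (g : Hom b c) (f f' : Hom a b) :
  g \cmp (f - f') = g \cmp f - g \cmp f'.
Proof. exact: (raddfB (postcomp a g)). Qed.

Lemma to_zero_obj a (f : Hom a zero_obj) : f = 0.
Proof. by have [_ toz] := @zero_objP A a; apply: toz. Qed.

Lemma from_zero_obj a (f : Hom zero_obj a) : f = 0.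
Proof. by have [fromz _] := @zero_objP A a; apply: fromz. Qed.

End Morphisms.

(** * Acyclicity in elementary terms *)

Section Acyclicity.
Variable A : abelian_category.
Implicit Types (X Y : subcategory A) (K : complex A).

(** Exactness at [b] of [a -> b -> c] after applying [Hom(x, -)]. *)
Definition rexact (x a b c : A) (f : Hom a b) (g : Hom b c) : Prop :=
  forall v : Hom x b, g \cmp v = 0 -> exists u, f \cmp u = v.

(** Exactness at [b] of [a -> b -> c] after applying [Hom(-, y)]. *)
Definition lexact (y a b c : A) (f : Hom a b) (g : Hom b c) : Prop :=
  forall v : Hom b y, v \cmp f = 0 -> exists u, u \cmp g = v.

Lemma right_acyclicE X K : right_acyclic X K <->
  forall x, X x -> forall i, rexact x (cx_d K i) (cx_d K (succi i)).
Proof.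
split=> acK x Xx i v; first by move/acK => /(_ Xx).
split; first exact: acK.
by case=> u <-; rewrite /postcomp cmpA cx_dd cmp0m.
Qed.

Lemma left_acyclicE Y K : left_acyclic Y K <->
  forall y, Y y -> forall i, lexact y (cx_d K i) (cx_d K (succi i)).
Proof.
split=> acK y Yy i v; first by move/acK => /(_ Yy).
split; first exact: acK.
by case=> u <-; rewrite /precomp -cmpA cx_dd cmpm0.
Qed.

Section Augmented.
Variables (X Y : subcategory A) (M : A).

Lemma left_augmented_racyclicP (P : left_augmented M) :
  right_acyclic X (left_augmented_complex P) <->
  forall x, X x ->
    [/\ forall w : Hom x M, exists v, la_aug P \cmp v = w,
        rexact x (la_d P 0) (la_aug P)
      & forall n, rexact x (la_d P n.+1) (la_d P n)].
Proof.
rewrite right_acyclicE; split=> acP x Xx.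
  split=> [w||n]; first exact: (acP x Xx (Negz 0) w (cmp0m _ _)).
    exact: (acP x Xx (Negz 1)).
  exact: (acP x Xx (Negz n.+2)).
have [sur ex0 exS] := acP x Xx.
case=> [n|[|[|n]]] v /=; [|by move=> _; apply: sur|exact: ex0|exact: exS].
by move=> _; exists 0; rewrite (to_zero_obj v) cmpm0.
Qed.

Lemma left_augmented_lacyclicP (P : left_augmented M) :
  left_acyclic Y (left_augmented_complex P) <->
  forall y, Y y ->
    [/\ forall u : Hom M y, u \cmp la_aug P = 0 -> u = 0,
        lexact y (la_d P 0) (la_aug P)
      & forall n, lexact y (la_d P n.+1) (la_d P n)].
Proof.
rewrite left_acyclicE; split=> acP y Yy.
  split=> [u||n]; last 2 first.
  - exact: (acP y Yy (Negz 1)).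
  - exact: (acP y Yy (Negz n.+2)).
  by case/(acP y Yy (Negz 0)) => v <-; apply: cmpm0.
have [inj ex0 exS] := acP y Yy.
case=> [n|[|[|n]]] v /=; [| |exact: ex0|exact: exS].
  by move=> _; exists 0; rewrite (from_zero_obj v) cmp0m.
by move/inj->; exists 0; rewrite cmp0m.
Qed.

Lemma right_augmented_racyclicP (Q : right_augmented M) :
  right_acyclic X (right_augmented_complex Q) <->
  forall x, X x ->
    [/\ forall u : Hom x M, ra_aug Q \cmp u = 0 -> u = 0,
        rexact x (ra_aug Q) (ra_d Q 0)
      & forall n, rexact x (ra_d Q n) (ra_d Q n.+1)].
Proof.
rewrite right_acyclicE; split=> acQ x Xx.
  split=> [u||n]; last 2 first.
  - exact: (acQ x Xx (Posz 0)).
  - exact: (acQ x Xx (Posz n.+1)).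
  by case/(acQ x Xx (Negz 0)) => v <-; apply: cmp0m.
have [inj ex0 exS] := acQ x Xx.
case=> [[|n]|[|n]] v /=; [exact: ex0|exact: exS| |].
  by move/inj->; exists 0; rewrite cmpm0.
by move=> _; exists 0; rewrite (to_zero_obj v) cmpm0.
Qed.

Lemma right_augmented_lacyclicP (Q : right_augmented M) :
  left_acyclic Y (right_augmented_complex Q) <->
  forall y, Y y ->
    [/\ forall w : Hom M y, exists v, v \cmp ra_aug Q = w,
        lexact y (ra_aug Q) (ra_d Q 0)
      & forall n, lexact y (ra_d Q n) (ra_d Q n.+1)].
Proof.
rewrite left_acyclicE; split=> acQ y Yy.
  split=> [w||n]; first exact: (acQ y Yy (Negz 0) w (cmpm0 _ _)).
    exact: (acQ y Yy (Posz 0)).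
  exact: (acQ y Yy (Posz n.+1)).
have [sur ex0 exS] := acQ y Yy.
case=> [[|n]|[|n]] v /=; [exact: ex0|exact: exS|by move=> _; apply: sur|].
by move=> _; exists 0; rewrite (from_zero_obj v) cmp0m.
Qed.

End Augmented.

Section Short.
Variables (X Y : subcategory A) (L M N : A).
Variables (f : Hom L M) (g : Hom M N) (gf0 : g \cmp f = 0).

Lemma short_racyclicP : right_acyclic X (short_complex gf0) <->
  forall x, X x ->
    [/\ forall u : Hom x L, f \cmp u = 0 -> u = 0,
        rexact x f g
      & forall w : Hom x N, exists v, g \cmp v = w].
Proof.
rewrite right_acyclicE; split=> acK x Xx.
  split=> [u||w].
  - by case/(acK x Xx (Negz 0)) => v <-; apply: cmp0m.
  - exact: (acK x Xx (Posz 0)).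
  - exact: (acK x Xx (Posz 1) w (cmp0m _ _)).
have [inj ex sur] := acK x Xx.
case=> [[|[|n]]|[|n]] v /=; [exact: ex|by move=> _; apply: sur| | |].
- by move=> _; exists 0; rewrite (to_zero_obj v) cmpm0.
- by move/inj->; exists 0; rewrite cmpm0.
- by move=> _; exists 0; rewrite (to_zero_obj (v : Hom x zero_obj)) cmpm0.
Qed.

Lemma short_lacyclicP : left_acyclic Y (short_complex gf0) <->
  forall y, Y y ->
    [/\ forall u : Hom N y, u \cmp g = 0 -> u = 0,
        lexact y f g
      & forall w : Hom L y, exists v, v \cmp f = w].
Proof.
rewrite left_acyclicE; split=> acK y Yy.
  split=> [u||w].
  - by case/(acK y Yy (Posz 1)) => v <-; apply: cmpm0.
  - exact: (acK y Yy (Posz 0)).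
  - exact: (acK y Yy (Negz 0) w (cmpm0 _ _)).
have [inj ex sur] := acK y Yy.
case=> [[|[|n]]|[|n]] v /=; [exact: ex| | |by move=> _; apply: sur|].
- by move/inj->; exists 0; rewrite cmp0m.
- by move=> _; exists 0; rewrite (from_zero_obj v) cmp0m.
- by move=> _; exists 0; rewrite (from_zero_obj (v : Hom zero_obj y)) cmp0m.
Qed.

End Short.

End Acyclicity.

(** * Vanishing of cohomology *)

Lemma pi_quot_eq0 (V : zmodType) (I : zmodClosed V) (z : V) :
  ((\pi_(Quotient.quot I) z)%qT == 0 :> Quotient.quot I) = (z \in I).
Proof.
by rewrite -[z in RHS]subr0 Quotient.idealrBE (raddf0 \pi_(Quotient.quot I)%qT).
Qed.

Lemma cohomology_trivialP (U V W : zmodType) (f : {additive U -> V})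
    (g : {additive V -> W}) :
  trivial_group (cohomology f g) <->
  forall v, g v = 0 -> exists u, f u = v.
Proof.
split=> [triv v gv0|lift q].
  have v_coc : v \in is_cocycle g by rewrite unfold_in /is_cocycle gv0.
  have := pi_quot_eq0 (coboundaries f g) (Cocycle v_coc).
  by rewrite (triv (\pi _)%qT) eqxx => /esym; rewrite unfold_in => /asboolP.
rewrite -[q]reprK; apply/eqP; rewrite pi_quot_eq0 unfold_in; apply/asboolP.
by apply: lift; apply/eqP; case: (repr q).
Qed.

(** [H^(n+1)(Hom(P, N)) = 0] for the deleted complex [P], on cocycles. *)
Definition ext_vanishes (A : abelian_category) (M : A) (P : left_augmented M)
    (N : A) (n : nat) : Prop :=
  lexact N (la_d P n.+1) (la_d P n).

Lemma hom_cohomology_trivialP (A : abelian_category) (M : A)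
    (P : left_augmented M) (N : A) (n : nat) :
  trivial_group (hom_cohomology P N n.+1) <-> ext_vanishes P N n.
Proof. exact: cohomology_trivialP. Qed.

(** * Star-acyclic resolutions *)

Section Resolutions.
Variables (A : abelian_category) (X Y : subcategory A).
Implicit Types (M N : A).

(** An [X]-resolution which is also left [Y]-acyclic. *)
Definition star_resolution M (P : left_augmented M) : Prop :=
  (forall n, X (P n)) /\ star_acyclic X Y (left_augmented_complex P).

(** A [Y]-coresolution which is also right [X]-acyclic. *)
Definition star_coresolution N (Q : right_augmented N) : Prop :=
  (forall n, Y (Q n)) /\ star_acyclic X Y (right_augmented_complex Q).

Hypothesis bp : balanced_pair X Y.

Lemma chosen_star_resolution M : star_resolution (chosen_resolution bp M).
Proof.
split; first exact: res_mem.
split; first exact: res_acyclic.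
exact: svalP (cid (bp_resolution bp M)).
Qed.

Lemma star_coresolution_exists N : exists Q : right_augmented N,
  star_coresolution Q.
Proof.
have [Q acQ] := bp_coresolution bp N; exists Q.
by split; [exact: cores_mem|split; [exact: acQ|exact: cores_acyclic]].
Qed.

Lemma Ext_trivialP M N n :
  trivial_group (Ext bp n.+1 M N) <-> ext_vanishes (chosen_resolution bp M) N n.
Proof. exact: hom_cohomology_trivialP. Qed.

Lemma ext_vanishes_Y M (P : left_augmented M) (y : A) n :
  star_resolution P -> Y y -> ext_vanishes P y n.
Proof.
by move=> [_ [_ /left_augmented_lacyclicP acP]] /acP[_ _ exS]; apply: exS.
Qed.

(** An [X]-approximation need not be an epimorphism, but morphisms into objects
    of [Y] do not see the difference: it factors the augmentation of a
    star-acyclic resolution, and the latter has this property. *)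
Lemma approximation_inj (K x y : A) (p : Hom x K) (u : Hom K y) :
  (forall x', X x' -> forall w : Hom x' K, exists v, p \cmp v = w) ->
  Y y -> u \cmp p = 0 -> u = 0.
Proof.
move=> surp Yy up0; have [memR [_ acR]] := chosen_star_resolution K.
have [injR _ _] := (left_augmented_lacyclicP _ _).1 acR y Yy.
have [v def_aug] := surp _ (memR 0%N) (la_aug (chosen_resolution bp K)).
by apply: injR; rewrite -def_aug cmpA up0 cmp0m.
Qed.

Section Syzygy.
Variables (M : A) (P : left_augmented M).
Hypothesis starP : star_resolution P.
Variables (K : A) (k : Hom K (P 0%N)) (p : Hom (P 1%N) K).
Hypotheses (kerk : is_kernel k (la_aug P)) (kp : k \cmp p = la_d P 0%N).

Lemma kernel_inj (a : A) (u : Hom a K) : k \cmp u = 0 -> u = 0.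
Proof.
move=> ku0; have [h [_ uniq_h]] := kerk.2 a 0 (cmpm0 _ _).
by rewrite -(uniq_h u ku0); apply: uniq_h; rewrite cmpm0.
Qed.

Lemma syzygy_augd : p \cmp la_d P 1 = 0.
Proof. by apply: kernel_inj; rewrite cmpA kp la_dd. Qed.

Lemma syzygy_aug_surj (x : A) : X x ->
  forall w : Hom x K, exists v, p \cmp v = w.
Proof.
move=> Xx w; have [_ [racP _]] := starP.
have [_ ex0 _] := (left_augmented_racyclicP _ _).1 racP x Xx.
have [v def_kw] : exists v, la_d P 0 \cmp v = k \cmp w.
  by apply: ex0; rewrite cmpA kerk.1 cmp0m.
exists v; apply/eqP; rewrite -subr_eq0; apply/eqP/kernel_inj.
by rewrite cmpBr cmpA kp def_kw subrr.
Qed.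

Lemma syzygy_aug_inj (y : A) (u : Hom K y) : Y y -> u \cmp p = 0 -> u = 0.
Proof. by move=> Yy; apply: approximation_inj Yy; apply: syzygy_aug_surj. Qed.

(** The resolution [P] without its term of degree [0], as a resolution of the
    kernel of the augmentation. *)
Definition syzygy_resolution : left_augmented K :=
  @LeftAugmented A K (fun n => P n.+1) (fun n => la_d P n.+1) p
    (fun n => la_dd P n.+1) syzygy_augd.

Lemma syzygy_star_resolution : star_resolution syzygy_resolution.
Proof.
have [memP [racP lacP]] := starP; split=> [n|]; first exact: memP.
split.
  apply/left_augmented_racyclicP => x Xx.
  have [_ _ exS] := (left_augmented_racyclicP _ _).1 racP x Xx.
  split=> [||n] /=; [exact: syzygy_aug_surj| |exact: exS].
  by move=> v pv0; apply: exS; rewrite -kp -cmpA pv0 cmpm0.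
apply/left_augmented_lacyclicP => y Yy.
have [_ _ exS] := (left_augmented_lacyclicP _ _).1 lacP y Yy.
split=> [u||n] /=; [exact: syzygy_aug_inj| |exact: exS].
by move=> v /exS[u def_v]; exists (u \cmp k); rewrite -cmpA kp.
Qed.

Lemma syzygy_star_acyclic : star_acyclic X Y (short_complex kerk.1).
Proof.
have [_ [racP lacP]] := starP; split.
  apply/short_racyclicP => x Xx.
  have [surP _ _] := (left_augmented_racyclicP _ _).1 racP x Xx.
  split=> // [u|v]; first exact: kernel_inj.
  by case/kerk.2 => h [kh _]; exists h.
apply/short_lacyclicP => y Yy.
have [injP ex0 exS] := (left_augmented_lacyclicP _ _).1 lacP y Yy.
split=> // [v vk0|w]; first by apply: ex0; rewrite -kp cmpA vk0 cmp0m.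
have [h def_h] : exists h, h \cmp la_d P 0 = w \cmp p.
  by apply: exS; rewrite -cmpA syzygy_augd cmpm0.
exists h; apply/eqP; rewrite -subr_eq0; apply/eqP/(syzygy_aug_inj Yy).
by rewrite cmpBl -cmpA kp def_h subrr.
Qed.

End Syzygy.

(** Every star-acyclic resolution [P] of [M] can be cut into the star-acyclic
    complex [0 -> K -> P 0 -> M -> 0] and a star-acyclic resolution of [K]
    whose cohomology is that of [P], shifted by one. *)
Lemma syzygy_exists M (P : left_augmented M) : star_resolution P ->
  exists (K : A) (k : Hom K (P 0%N)) (ek : la_aug P \cmp k = 0)
    (P' : left_augmented K),
    [/\ star_acyclic X Y (short_complex ek), star_resolution P'
      & forall N n, ext_vanishes P' N n = ext_vanishes P N n.+1].
Proof.
move=> starP; have [K [k kerk]] := abelian_kernel (la_aug P).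
have [p [kp _]] := kerk.2 _ (la_d P 0%N) (la_augd P).
exists K, k, kerk.1, (syzygy_resolution kerk kp); split=> //.
- exact: (syzygy_star_acyclic starP kerk kp).
- exact: syzygy_star_resolution.
Qed.

End Resolutions.

(** * The opposite category *)

(** Same objects, [Hom] groups and identities, composition reversed. *)
Definition op_preadditive (A : preadditive) : preadditive :=
  @Preadditive A (fun a b => Hom b a) (@idm A) (fun a b c g f => f \cmp g)
    (fun a b c d h g f => esym (cmpA f g h))
    (fun a b f => cmpm1 f) (fun a b f => cmp1m f)
    (fun a b c g g' f => cmpDr f g g') (fun a b c g f f' => cmpDl f f' g).

Lemma op_biproduct (A : preadditive) (a b s : A) :
  is_biproduct a b s -> @is_biproduct (op_preadditive A) a b s.
Proof. by move=> [i [j [p [q [pi qj pj qi ijpq]]]]]; exists p, q, i, j. Qed.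

Lemma biproduct_op (A : preadditive) (a b s : A) :
  @is_biproduct (op_preadditive A) a b s -> is_biproduct a b s.
Proof. by move=> [i [j [p [q [pi qj pj qi ijpq]]]]]; exists p, q, i, j. Qed.

Lemma isomorphic_op (A : preadditive) (a b : A) :
  @isomorphic (op_preadditive A) a b -> isomorphic a b.
Proof. by move=> [f [g [gf fg]]]; exists g, f. Qed.

(** Transparent, so that objects and morphisms of the opposite category are
    convertible with those of [A]. *)
Definition op_abelian (A : abelian_category) : abelian_category.
Proof.
apply: (@AbelianCategory (op_preadditive A) (@zero_obj A)) => [b|a b|a b f|||].
- by have [fromz toz] := @zero_objP A b; split.
- by have [s /op_biproduct ab_s] := abelian_biproduct a b; exists s.
- exact: (abelian_cokernel (f : @Hom A b a)).
- move=> a b f; exact: (abelian_kernel (f : @Hom A b a)).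
- move=> a b i; exact: (@abelian_epi A b a i).
- move=> a b p; exact: (@abelian_mono A b a p).
Defined.

(** The same class of objects, in the opposite category. *)
Definition op_subcategory (A : abelian_category) (E : subcategory A) :
  subcategory (op_abelian A).
Proof.
apply: (@Subcategory (op_abelian A) (subcat_mem E)).
- exact: subcat_zero.
- by move=> a b s /biproduct_op; apply: subcat_biproduct.
- by move=> a b /isomorphic_op; apply: subcat_iso.
- by move=> a b s /biproduct_op; apply: subcat_summand.
Defined.

Notation "A ^op" := (op_abelian A) (at level 2, format "A ^op") : cat_scope.
Notation "E ^sop" := (op_subcategory E) (at level 2, format "E ^sop").

Section Opposite.
Variables (A : abelian_category) (X Y : subcategory A).

(** [... -> P 1 -> P 0 -> M], read in the opposite category as
    [M -> P 0 -> P 1 -> ...]. *)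
Definition op_left_augmented (M : A) (P : left_augmented M) :
    @right_augmented A^op M :=
  @RightAugmented A^op M P (la_d P) (la_aug P) (la_dd P) (la_augd P).

(** [N -> Q 0 -> Q 1 -> ...], read in the opposite category as
    [... -> Q 1 -> Q 0 -> N]. The condition
    [ext_vanishes (op_right_augmented Q) M n] thus says that
    [H^(n+1)(Hom(M, Q)) = 0]. *)
Definition op_right_augmented (N : A) (Q : right_augmented N) :
    @left_augmented A^op N :=
  @LeftAugmented A^op N Q (ra_d Q) (ra_aug Q) (ra_dd Q) (ra_daug Q).

Lemma op_star_resolution (M : A) (P : left_augmented M) :
  star_resolution X Y P -> star_coresolution Y^sop X^sop (op_left_augmented P).
Proof.
move=> [memP [/left_augmented_racyclicP racP /left_augmented_lacyclicP lacP]].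
split=> //; split; first by apply/right_augmented_racyclicP.
exact/right_augmented_lacyclicP.
Qed.

Lemma op_star_coresolution (N : A) (Q : right_augmented N) :
  star_coresolution X Y Q -> star_resolution Y^sop X^sop (op_right_augmented Q).
Proof.
move=> [memQ [/right_augmented_racyclicP racQ /right_augmented_lacyclicP lacQ]].
split=> //; split; first by apply/left_augmented_racyclicP.
exact/left_augmented_lacyclicP.
Qed.

Lemma op_short_star_acyclic (L M N : A) (f : Hom L M) (g : Hom M N)
    (gf0 : g \cmp f = 0) :
  star_acyclic X Y (short_complex gf0) <->
  star_acyclic Y^sop X^sop (@short_complex A^op N M L g f gf0).
Proof.
split=> [[/short_racyclicP rac /short_lacyclicP lac]
        |[/short_racyclicP rac /short_lacyclicP lac]]; split.
- by apply/short_racyclicP.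
- by apply/short_lacyclicP.
- by apply/short_racyclicP.
- by apply/short_lacyclicP.
Qed.

Lemma op_balanced_pair : balanced_pair X Y -> balanced_pair Y^sop X^sop.
Proof.
move=> bp; split.
- exact: bp_covariantly_finite bp.
- exact: bp_contravariantly_finite bp.
- move=> N; have [Q /op_star_coresolution[memQ [racQ lacQ]]] :=
    star_coresolution_exists bp N.
  by exists (Resolution memQ racQ).
- move=> M; have /op_star_resolution[memP [racP lacP]] :=
    chosen_star_resolution bp M.
  by exists (Coresolution memP lacP).
Qed.

Lemma op_Y_coresolving (E : subcategory A) :
  Y_coresolving X Y E -> X_resolving Y^sop X^sop E^sop.
Proof.
case=> memE extE monoE; split=> // L M N f g gf0.
  by move=> /(op_short_star_acyclic (f := g)) ac EL EN; apply: extE ac _ _.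
by move=> /(op_short_star_acyclic (f := g)) ac EM EN; apply: monoE ac _ _.
Qed.

Lemma X_resolving_op (E : subcategory A) :
  Y_coresolving Y^sop X^sop E^sop -> X_resolving X Y E.
Proof.
case=> memE extE monoE; split=> // L M N f g gf0.
  by move=> /op_short_star_acyclic ac EL EN; apply: extE ac _ _.
by move=> /op_short_star_acyclic ac EM EN; apply: monoE ac _ _.
Qed.

End Opposite.

(** * Balance in degree one *)

(** A chase in the double complex [Hom(P i, Q j)]: a cocycle [M -> Q 1] is
    transported to a cocycle [P 1 -> N], and a cochain bounding the latter back
    to one bounding the former. *)
Lemma ext1_vanishes_balance (A : abelian_category) (X Y : subcategory A)
    (M N : A) (P : left_augmented M) (Q : right_augmented N) :
  star_resolution X Y P -> star_coresolution X Y Q ->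
  ext_vanishes P N 0 -> ext_vanishes (op_right_augmented Q) M 0.
Proof.
move=> [memP [_ /left_augmented_lacyclicP lacP]].
move=> [memQ [/right_augmented_racyclicP racQ _]] vanP.
(* The same statement, read in [A] rather than in the opposite category. *)
suff: forall g : Hom M (Q 1%N), ra_d Q 1 \cmp g = 0 ->
  exists h, ra_d Q 0 \cmp h = g by [].
move=> g dg0.
have [_ _ exQ0] := racQ _ (memP 0%N).
have [_ exQ1 _] := racQ _ (memP 1%N).
have [injQ2 _ _] := racQ _ (memP 2%N).
have [_ exP0 _] := lacP _ (memQ 0%N).
have [injP1 _ _] := lacP _ (memQ 1%N).
have [h def_h] : exists h, ra_d Q 0 \cmp h = g \cmp la_aug P.
  by apply: exQ0; rewrite cmpA dg0 cmp0m.
have [f def_f] : exists f, ra_aug Q \cmp f = h \cmp la_d P 0.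
  by apply: exQ1; rewrite cmpA def_h -cmpA la_augd cmpm0.
have [f' def_f'] : exists f', f' \cmp la_d P 0 = f.
  by apply: vanP; apply: injQ2; rewrite cmpA def_f -cmpA la_dd cmpm0.
have [h' def_h'] : exists h', h' \cmp la_aug P = h - ra_aug Q \cmp f'.
  by apply: exP0; rewrite cmpBl -cmpA def_f' def_f subrr.
exists h'; apply/eqP; rewrite -subr_eq0; apply/eqP/injP1.
by rewrite cmpBl -cmpA def_h' cmpBr def_h cmpA ra_daug cmp0m subr0 subrr.
Qed.

Lemma ext1_vanishes_balanceE (A : abelian_category) (X Y : subcategory A)
    (M N : A) (P : left_augmented M) (Q : right_augmented N) :
  star_resolution X Y P -> star_coresolution X Y Q ->
  ext_vanishes P N 0 <-> ext_vanishes (op_right_augmented Q) M 0.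
Proof.
move=> starP starQ; split; first exact: ext1_vanishes_balance starP starQ.
exact: (ext1_vanishes_balance (op_star_coresolution starQ)
                              (op_star_resolution starP)).
Qed.

Lemma ext1_vanishes_indep (A : abelian_category) (X Y : subcategory A)
    (M N : A) (P P' : left_augmented M) : balanced_pair X Y ->
  star_resolution X Y P -> star_resolution X Y P' ->
  ext_vanishes P N 0 <-> ext_vanishes P' N 0.
Proof.
move=> bp starP starP'; have [Q starQ] := star_coresolution_exists bp N.
by rewrite (ext1_vanishes_balanceE starP starQ)
           (ext1_vanishes_balanceE starP' starQ).
Qed.

Lemma op_Ext1_trivial (A : abelian_category) (X Y : subcategory A)
    (bp : balanced_pair X Y) (M N : A) :
  trivial_group (Ext bp 1 M N) <->
  trivial_group (Ext (op_balanced_pair bp) 1 (N : A^op) (M : A^op)).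
Proof.
rewrite !Ext_trivialP.
have [Q starQ] := star_coresolution_exists bp N.
rewrite (ext1_vanishes_balanceE (chosen_star_resolution bp M) starQ).
apply: ext1_vanishes_indep (op_balanced_pair bp) _ _.
  exact: op_star_coresolution.
exact: chosen_star_resolution.
Qed.

Lemma op_cotorsion_pair (A : abelian_category) (X Y : subcategory A)
    (bp : balanced_pair X Y) (C D : subcategory A) :
  cotorsion_pair bp C D -> cotorsion_pair (op_balanced_pair bp) D^sop C^sop.
Proof.
move=> [defC defD]; split=> [N|M].
  rewrite /= defD; split=> van M CM; apply/(op_Ext1_trivial bp M N);
  exact: van.
rewrite /= defC; split=> van N DN; apply/(op_Ext1_trivial bp M N); exact: van.
Qed.

(** * Relative cotorsion pairs *)

Section CotorsionPairs.
Variables (A : abelian_category) (X Y : subcategory A) (bp : balanced_pair X Y).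
Variables (C D : subcategory A) (cp : cotorsion_pair bp C D).
Implicit Types (M N : A).

(** Vanishing of all the higher Ext groups between [C] and [D]. *)
Definition Ext_orthogonal : Prop :=
  forall i : nat, (1 <= i)%N ->
  forall M N : A, C M -> D N -> trivial_group (Ext bp i M N).

(** By closure under star-epimorphisms all syzygies of objects of [C] lie in
    [C], so that dimension shifting reduces to [Ext^1]. *)
Lemma resolving_ext_vanishes : X_resolving X Y C ->
  forall n M (P : left_augmented M) N,
    star_resolution X Y P -> C M -> D N -> ext_vanishes P N n.
Proof.
move=> [XC _ epiC]; elim=> [|n IHn] M P N starP CM DN.
  apply/(ext1_vanishes_indep _ bp (chosen_star_resolution bp M) starP).
  by apply/Ext_trivialP; apply: (cp.1 M).1.
have [K [k [ek [P' [acK starP' <-]]]]] := syzygy_exists bp starP.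
apply: IHn => //; apply: epiC acK _ CM.
by apply: XC; apply: starP.1.
Qed.

Lemma resolving_Ext_orthogonal : X_resolving X Y C -> Ext_orthogonal.
Proof.
move=> resC [|n] // _ M N CM DN; apply/Ext_trivialP.
by apply: resolving_ext_vanishes => //; apply: chosen_star_resolution.
Qed.

(** Closure under star-extensions uses [Ext^1(-, L)] and [Ext^1(-, N)]; closure
    under star-monomorphisms uses [Ext^2(-, L)] and [Ext^1(-, M)]. *)
Lemma Ext_orthogonal_coresolving : Ext_orthogonal -> Y_coresolving X Y D.
Proof.
move=> orth.
have vanish M N n : C M -> D N -> ext_vanishes (chosen_resolution bp M) N n.
  by move=> CM DN; apply/Ext_trivialP/orth.
have memD N :
    (forall M, C M -> ext_vanishes (chosen_resolution bp M) N 0) -> D N.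
  by move=> vanN; apply/cp.2 => M CM; apply/Ext_trivialP/vanN.
split=> [y Yy|L M N f g gf0 [/short_racyclicP rac _] DL DN
             |L M N f g gf0 [/short_racyclicP rac _] DL DM].
- by apply: memD => M _; apply: ext_vanishes_Y (chosen_star_resolution bp M) Yy.
- apply: memD => C0 CC0.
  have [memP _] := chosen_star_resolution bp C0.
  have vL := vanish C0 L 0%N CC0 DL; have vN := vanish C0 N 0%N CC0 DN.
  move: (chosen_resolution bp C0 : left_augmented _) memP vL vN => P memP vL vN.
  have [_ _ lift0] := rac _ (memP 0%N).
  have [_ ex1 _] := rac _ (memP 1%N).
  have [inj2 _ _] := rac _ (memP 2%N).
  (* The image of [v] in [N] bounds; correcting [v] by a lift of a bounding
     cochain yields a cocycle with values in [L]. *)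
  move=> v vd0.
  have [h def_h] : exists h, h \cmp la_d P 0 = g \cmp v.
    by apply: vN; rewrite -cmpA vd0 cmpm0.
  have [h' def_h'] := lift0 h.
  have [w def_w] : exists w, f \cmp w = v - h' \cmp la_d P 0.
    by apply: ex1; rewrite cmpBr cmpA def_h' def_h subrr.
  have [w' def_w'] : exists w', w' \cmp la_d P 0 = w.
    apply: vL; apply: inj2.
    by rewrite cmpA def_w cmpBl vd0 -cmpA la_dd cmpm0 subrr.
  exists (f \cmp w' + h').
  by rewrite cmpDl -cmpA def_w' def_w subrK.
- apply: memD => C0 CC0.
  have [memP _] := chosen_star_resolution bp C0.
  have vL := vanish C0 L 1%N CC0 DL; have vM := vanish C0 M 0%N CC0 DM.
  move: (chosen_resolution bp C0 : left_augmented _) memP vL vM => P memP vL vM.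
  have [_ _ lift1] := rac _ (memP 1%N).
  have [_ ex2 _] := rac _ (memP 2%N).
  have [inj3 _ _] := rac _ (memP 3%N).
  (* The coboundary of a lift [v'] of [v] to [M] is a cocycle [P 2 -> L], the
     connecting image of [v]; as it bounds, [v'] can be corrected to a cocycle
     with values in [M]. *)
  move=> v vd0; have [v' def_v] := lift1 v.
  have [w def_w] : exists w, f \cmp w = v' \cmp la_d P 1.
    by apply: ex2; rewrite cmpA def_v vd0.
  have [w' def_w'] : exists w', w' \cmp la_d P 1 = w.
    by apply: vL; apply: inj3; rewrite cmpA def_w -cmpA la_dd cmpm0.
  have [h def_h] : exists h, h \cmp la_d P 0 = v' - f \cmp w'.
    by apply: vM; rewrite cmpBl -cmpA def_w' def_w subrr.
  exists (g \cmp h).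
  by rewrite -cmpA def_h cmpBr def_v cmpA gf0 cmp0m subr0.
Qed.

End CotorsionPairs.

Theorem theorem3p8 (A : abelian_category) (X Y : subcategory A)
    (bp : balanced_pair X Y) (C D : subcategory A)
    (cp : cotorsion_pair bp C D) :
  (X_resolving X Y C <-> Y_coresolving X Y D) /\
  (Y_coresolving X Y D <->
   forall i : nat, (1 <= i)%N ->
   forall M N : A, C M -> D N -> trivial_group (Ext bp i M N)).
Proof.
have res_orth := resolving_Ext_orthogonal cp.
have orth_cores := Ext_orthogonal_coresolving cp.
have cores_res : Y_coresolving X Y D -> X_resolving X Y C.
  move=> /op_Y_coresolving/(resolving_Ext_orthogonal (op_cotorsion_pair cp)).
  by move=> /(Ext_orthogonal_coresolving (op_cotorsion_pair cp))/X_resolving_op.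
split; split=> //; first by move=> /res_orth.
by move=> /cores_res.
Qed.
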